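(* Let $d\ge 1$ and let $X\subset\mathbb R^d$ be a finite point set. Let $T$ be a max-sum tree of $X$. Then $T$ is a Tverberg graph, i.e. \[ \bigcap_{xy\in E(T)} B(xy)\neq\emptyset . \]
   Context: For points $x,y\in\mathbb R^d$, $B(xy)$ denotes the closed Euclidean ball with diameter the segment $xy$ (center $\frac{x+y}{2}$, radius $\frac{\|x-y\|}{2}$). The cost of a graph whose vertices are points of $\mathbb R^d$ is the sum of the Euclidean lengths $\|a-b\|$ over its edges $ab$. A max-sum tree of a finite set $X\subset\mathbb R^d$ is a tree with vertex set $X$ whose cost is maximum among all trees with vertex set $X$. A graph $G$ with vertices in $\mathbb R^d$ is a Tverberg graph if the closed balls $B(xy)$, $xy\in E(G)$, have a common point. *)

(* Defs.v *)
From HB Require Import structures.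
From mathcomp Require Import all_boot all_order all_algebra finmap.
From mathcomp Require Import all_classical all_reals all_analysis.

Set Implicit Arguments.
Unset Strict Implicit.
Unset Printing Implicit Defensive.

Import Order.TTheory GRing.Theory Num.Theory.
Local Open Scope classical_set_scope.
Local Open Scope ring_scope.

(* The library norm on matrices is the sup norm, hence this definition. *)
Definition enorm (R : realType) (d : nat) (x : 'rV[R]_d) : R :=
  Num.sqrt (\sum_(i < d) x 0 i ^+ 2).

Definition diam_ball (R : realType) (d : nat) (x y : 'rV[R]_d) : set 'rV[R]_d :=
  [set p | enorm (p - 2^-1 *: (x + y)) <= enorm (x - y) / 2].

Definition simple_graph (V : finType) (e : rel V) : Prop :=
  symmetric e /\ irreflexive e.

Definition connected_graph (V : finType) (e : rel V) : Prop :=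
  forall x y : V, connect e x y.

(* For symmetric e, [:: x; y] is an e-cycle as soon as e x y holds, so only
   the duplicate-free cycles through at least three vertices are cycles of the
   graph. *)
Definition acyclic_graph (V : finType) (e : rel V) : Prop :=
  forall c : seq V, ucycle e c -> (size c <= 2)%N.

Definition is_tree (V : finType) (e : rel V) : Prop :=
  [/\ simple_graph e, connected_graph e & acyclic_graph e].

(* The sum ranges over ordered pairs, so it meets each edge twice. *)
Definition cost (R : realType) (d : nat) (X : {fset 'rV[R]_d}) (e : rel X) : R :=
  (\sum_(p : X * X | e p.1 p.2) enorm (val p.1 - val p.2)) / 2.

Definition max_sum_tree (R : realType) (d : nat) (X : {fset 'rV[R]_d})
    (T : rel X) : Prop :=
  is_tree T /\ forall T' : rel X, is_tree T' -> cost T' <= cost T.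

Definition Tverberg_graph (R : realType) (d : nat) (X : {fset 'rV[R]_d})
    (e : rel X) : Prop :=
  \bigcap_(p in [set p : X * X | e p.1 p.2]) diam_ball (val p.1) (val p.2)
    !=set0.

(* Main.v *)
(**
The centre [p] of the smallest ball enclosing [X] lies in every ball with
diameter an edge of the max-sum tree [T]. The point [p] is a convex
combination of points of [X] that all lie at maximal distance from [p]. If [p]
were outside the ball of an edge [x y], then [c = <x - p, y - p> > 0].
Deleting [x y] splits [T] into two sides, and by the exchange argument [|a -
b| <= |x - y|] for [a] and [b] on different sides; when [a] and [b] are at
maximal distance from [p], this gives [<a - p, b - p> >= c], and the same with
[a] replaced by [x] or [b] by [y]. Hence the two partial sums, over the two
sides, of the vanishing convex combination of the vectors [a - p] have
positive inner product although they are opposite, or one side carries all the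
weight, and then the combination has positive inner product with [x - p] or [y
- p].
*)

Require Import Defs.
From HB Require Import structures.
From mathcomp Require Import all_boot all_order all_algebra finmap.
From mathcomp Require Import all_classical all_reals all_analysis.
From mathcomp Require Import ring lra.

Set Implicit Arguments.
Unset Strict Implicit.
Unset Printing Implicit Defensive.

Import Order.TTheory GRing.Theory Num.Theory.
Import numFieldNormedType.Exports.
Local Open Scope classical_set_scope.
Local Open Scope ring_scope.

(** * Exchanging one edge of a tree *)

Section EdgeExchange.
Variable V : finType.
Implicit Types (e : rel V) (a b x y u v : V).

Definition add_edge e a b : rel V :=
  fun u v => [|| e u v, (u == a) && (v == b) | (u == b) && (v == a)].

Definition del_edge e a b : rel V :=
  fun u v => e u v && ~~ ((u == a) && (v == b) || (u == b) && (v == a)).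

Lemma add_edge_sym e a b : symmetric e -> symmetric (add_edge e a b).
Proof.
by move=> es u v; rewrite /add_edge es ![(v == _) && _]andbC; congr orb;
  rewrite orbC.
Qed.

Lemma del_edge_sym e a b : symmetric e -> symmetric (del_edge e a b).
Proof.
by move=> es u v; rewrite /del_edge es ![(v == _) && _]andbC orbC.
Qed.

Lemma add_del_edge e a b : symmetric e -> e a b ->
  add_edge (del_edge e a b) a b =2 e.
Proof.
move=> es eab u v; rewrite /add_edge /del_edge.
have [/andP[/eqP-> /eqP->]|] := boolP ((u == a) && (v == b)).
  by rewrite eab orbT.
have [/andP[/eqP-> /eqP->]|] := boolP ((u == b) && (v == a)).
  by rewrite es eab !orbT.
by rewrite /= !orbF andbT.
Qed.

(** Removing the new edge from a cycle through it would leave a path of [e] joining [a] and [b];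
    every other cycle lies in [e]. *)
Lemma acyclic_add_edge e a b : symmetric e -> acyclic_graph e ->
  ~~ connect e a b -> acyclic_graph (add_edge e a b).
Proof.
move=> es ac nab c /andP[cc cu]; rewrite leqNgt; apply/negP => c3.
(* The new edge has [a] as an endpoint, so a path missing [a] runs in [e]. *)
have avoid u p : a \notin u :: p -> path (add_edge e a b) u p -> path e u p.
  elim: p u => //= v p IHp u; rewrite !inE !negb_or => /and3P[au av ap].
  case/andP=> uv pv; apply/andP; split.
    move: uv; rewrite /add_edge ![_ == a]eq_sym (negbTE au) (negbTE av) andbF.
    by rewrite /= orbF.
  by apply: IHp pv; rewrite inE negb_or av.
have [ac'|ac'] := boolP (a \in c); last first.
  have : ucycle e c.
    apply/andP; split => //; case: c cc {cu c3} ac' => //= u p pu ap.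
    by apply: avoid pu; rewrite in_cons mem_rcons orbA orbb.
  by move/ac; rewrite leqNgt c3.
have [i p def_c] := rot_to ac'.
move: cc cu c3; rewrite -(rot_cycle i) -(rot_uniq i) -(size_rot i) def_c.
case: p {def_c} => [|q [|r p]] //= /andP[aq]; rewrite rcons_path /=.
move=> /and3P[qr rp la] /and4P[anot qnot rnot pu] _.
have /= /andP[{}qr {}rp] : path e q (r :: p).
  by apply: avoid => //=; rewrite qr.
have cql : connect e q (last r p).
  by apply/connectP; exists (r :: p) => //=; rewrite qr.
have ql : q != last r p by apply: contraNneq qnot => ->; exact: mem_last.
have qa : q != a by apply: contraNneq anot => ->; rewrite inE eqxx.
have lna : last r p != a.
  by apply: contraNneq anot => <-; rewrite inE mem_last orbT.
have ces : connect_sym e by exact: sym_connect_sym.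
move: aq; rewrite /add_edge eqxx (negbTE qa) andbF orbF /=.
(* If the cycle leaves [a] by the new edge, then [q] is [b]; the last vertex differs from [q], so
   the cycle returns to [a] by an edge of [e]. *)
case/orP => [aq|/eqP qb]; last first.
  move: la; rewrite /add_edge (negbTE lna) /= eqxx andbT -qb eq_sym.
  rewrite (negbTE ql) orbF => la.
  by case/negP: nab; rewrite -qb ces; apply: connect_trans cql (connect1 la).
move: la; rewrite /add_edge (negbTE lna) /= eqxx andbT.
case/orP => [la|/eqP lb]; last first.
  by case/negP: nab; rewrite -lb; apply: connect_trans (connect1 aq) cql.
have : ucycle e [:: a, q, r & p].
  apply/andP; split; first by rewrite /= aq qr rcons_path rp.
  by rewrite /= anot qnot rnot pu.
by move/ac.
Qed.

(** A duplicate-free path from [x] to [y] closes up with the edge to a cycle of [e]. Acyclicity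
    leaves only the path that is the edge itself, which was deleted. *)
Lemma del_edge_disconnect e x y : simple_graph e -> acyclic_graph e ->
  e x y -> ~~ connect (del_edge e x y) x y.
Proof.
move=> [es ei] ac exy; apply/negP => /connectP[p0 pp0 yl].
case/shortenP: pp0 yl => p pp pu _ yl.
have pe : path e x p by apply: sub_path pp => u v /andP[].
have : ucycle e (x :: p).
  by rewrite /ucycle pu andbT /= rcons_path pe -yl es.
move/ac; case: p pp yl {pe pu} => [|q [|r p]] //= pp yl.
  by rewrite yl ei in exy.
by move: pp; rewrite -yl /del_edge !eqxx andbF.
Qed.

Lemma del_edge_sides e x y u : symmetric e -> connected_graph e ->
  connect (del_edge e x y) x u || connect (del_edge e x y) y u.
Proof.
move=> es ec; have /connectP[p pp ->] := ec x u.
(* Induction along the path: a step over a kept edge stays in its component, and a step over the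
   deleted edge lands on [x] or [y]. *)
suff H v : connect (del_edge e x y) x v || connect (del_edge e x y) y v ->
    path e v p ->
    connect (del_edge e x y) x (last v p)
    || connect (del_edge e x y) y (last v p).
  by apply: H pp; rewrite connect0.
elim: p v {pp} => //= w p IHp v xyv /andP[vw]; apply: IHp.
have [/orP[/andP[_ /eqP->]|/andP[_ /eqP->]]|nvw] :=
    boolP ((v == x) && (w == y) || (v == y) && (w == x)).
- by rewrite connect0 orbT.
- by rewrite connect0.
have vw' : connect (del_edge e x y) v w by rewrite connect1 // /del_edge vw.
by case/orP: xyv => h; rewrite (connect_trans h vw') ?orbT.
Qed.

(** The edge [a b] rejoins the two components left by deleting [x y]. The second conclusion is kept
    for the comparison of costs, where [a b] must be a genuinely new edge. *)
Lemma tree_exchange e x y a b : is_tree e -> e x y ->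
    connect (del_edge e x y) x a -> connect (del_edge e x y) y b ->
  is_tree (add_edge (del_edge e x y) a b) /\ ~~ connect (del_edge e x y) a b.
Proof.
move=> [[es ei] ec eac] exy xa yb.
set e' := del_edge e x y in xa yb *.
have e's : symmetric e' by exact: del_edge_sym.
have ce's : connect_sym e' by exact: sym_connect_sym.
have sub u v : e' u v -> e u v by case/andP.
have nab : ~~ connect e' a b.
  have := del_edge_disconnect (conj es ei) eac exy; apply: contraNN => ab.
  apply: connect_trans xa (connect_trans ab _).
  by rewrite ce's.
have ab : a != b by apply: contraNneq nab => ->; rewrite connect0.
have ac' : acyclic_graph e'.
  move=> c /andP[cc cu]; apply: eac; rewrite /ucycle cu andbT.
  exact: sub_cycle cc.
split=> //; split.
- split; first exact: add_edge_sym.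
  move=> u; rewrite /add_edge (contraFF (@sub u u) (ei u)) /=.
  case: eqVneq => [->|_]; first by rewrite (negbTE ab) andbF.
  by rewrite andbF.
- set f := add_edge e' a b.
  have fs : connect_sym f by apply/sym_connect_sym/add_edge_sym.
  have sf u v : connect e' u v -> connect f u v.
    by apply: connect_sub => s t st; apply: connect1; rewrite /f /add_edge st.
  have fxy : connect f x y.
    apply: (connect_trans (sf _ _ xa)).
    apply: (@connect_trans _ _ b); last by apply: sf; rewrite ce's.
    by apply: connect1; rewrite /f /add_edge !eqxx orbT.
  have fx u : connect f x u.
    by case/orP: (del_edge_sides x y u es ec) => /sf // /(connect_trans fxy).
  by move=> u v; apply: connect_trans (fx v); rewrite fs.
- exact: acyclic_add_edge.
Qed.

Lemma sum_add_edge (R : zmodType) e a b (F : V * V -> R) :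
    symmetric e -> ~~ e a b -> a != b ->
  \sum_(p | add_edge e a b p.1 p.2) F p =
  F (a, b) + F (b, a) + \sum_(p | e p.1 p.2) F p.
Proof.
move=> es eab ab.
rewrite (bigD1 (a, b)) /=; last by rewrite /add_edge !eqxx orbT.
rewrite -addrA (bigD1 (b, a)) /=; last first.
  by rewrite /add_edge !eqxx !orbT /= xpair_eqE negb_and ab orbT.
congr (_ + (_ + _)); apply: eq_bigl => -[u v] /=.
rewrite /add_edge !xpair_eqE.
have [/andP[/eqP-> /eqP->]|] := boolP ((u == a) && (v == b)).
  by rewrite (negbTE eab).
have [/andP[/eqP-> /eqP->]|] := boolP ((u == b) && (v == a)).
  by rewrite es (negbTE eab) /= ?andbF.
by rewrite /= !orbF !andbT.
Qed.

End EdgeExchange.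

(** * The Euclidean inner product and balls on a diameter *)

Section InnerProduct.
Variables (R : realType) (d : nat).
Implicit Types u v w : 'rV[R]_d.

Definition dot u v : R := \sum_(i < d) u 0 i * v 0 i.

Lemma dotC u v : dot u v = dot v u.
Proof. by apply: eq_bigr => i _; rewrite mulrC. Qed.

Lemma dotDl u v w : dot (u + v) w = dot u w + dot v w.
Proof. by rewrite -big_split; apply: eq_bigr => i _; rewrite mxE mulrDl. Qed.

Lemma dotZl (c : R) u w : dot (c *: u) w = c * dot u w.
Proof. by rewrite mulr_sumr; apply: eq_bigr => i _; rewrite mxE mulrA. Qed.

Lemma dotDr u v w : dot w (u + v) = dot w u + dot w v.
Proof. by rewrite ![dot w _]dotC dotDl. Qed.

Lemma dotZr (c : R) u w : dot w (c *: u) = c * dot w u.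
Proof. by rewrite ![dot w _]dotC dotZl. Qed.

Lemma dotNl u w : dot (- u) w = - dot u w.
Proof. by rewrite -scaleN1r dotZl mulN1r. Qed.

Lemma dotNr u w : dot w (- u) = - dot w u.
Proof. by rewrite ![dot w _]dotC dotNl. Qed.

Lemma dot0l w : dot 0 w = 0.
Proof. by rewrite -(scale0r w) dotZl mul0r. Qed.

Lemma dot_suml (I : Type) (r : seq I) (P : pred I) (F : I -> 'rV[R]_d) w :
  dot (\sum_(i <- r | P i) F i) w = \sum_(i <- r | P i) dot (F i) w.
Proof.
by apply: (big_morph (dot^~ w)) => [u v|]; [exact: dotDl|exact: dot0l].
Qed.

Lemma dot_sumr (I : Type) (r : seq I) (P : pred I) (F : I -> 'rV[R]_d) w :
  dot w (\sum_(i <- r | P i) F i) = \sum_(i <- r | P i) dot w (F i).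
Proof. by rewrite dotC dot_suml; apply: eq_bigr => i _; rewrite dotC. Qed.

Definition dotE := (dotDl, dotDr, dotNl, dotNr, dotZl, dotZr).

Lemma dot_ge0 u : 0 <= dot u u.
Proof. by apply: sumr_ge0 => i _; rewrite -expr2 sqr_ge0. Qed.

Lemma enormE u : enorm u = Num.sqrt (dot u u).
Proof. by congr Num.sqrt; apply: eq_bigr => i _; rewrite expr2. Qed.

Lemma enorm_le u v : (enorm u <= enorm v) = (dot u u <= dot v v).
Proof. by rewrite !enormE ler_psqrt // qualifE /= dot_ge0. Qed.

Lemma enormZ (c : R) u : 0 <= c -> enorm (c *: u) = c * enorm u.
Proof.
move=> c0; rewrite !enormE dotZl dotZr mulrA -expr2 sqrtrM ?sqr_ge0 //.
by rewrite sqrtr_sqr ger0_norm.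
Qed.

Lemma enormN u : enorm (- u) = enorm u.
Proof. by rewrite !enormE dotNl dotNr opprK. Qed.

(* Thales: the ball with diameter [x, y] is the set of points seeing the
   segment under a non-acute angle. *)
Lemma diam_ballE (x y p : 'rV[R]_d) :
  diam_ball x y p <-> dot (x - p) (y - p) <= 0.
Proof.
rewrite /diam_ball /= mulrC -enormZ ?invr_ge0 // enorm_le.
rewrite !dotE (dotC y x) (dotC p x) (dotC p y).
by split; lra.
Qed.

End InnerProduct.

(** * Edges of a max-sum tree across a cut, and balanced systems of vectors *)

Lemma max_sum_tree_edge (R : realType) (d : nat) (X : {fset 'rV[R]_d})
    (T : rel X) (x y a b : X) :
    max_sum_tree T -> T x y ->
    connect (del_edge T x y) x a -> connect (del_edge T x y) y b ->
  enorm (val a - val b) <= enorm (val x - val y).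
Proof.
move=> [treeT maxT] Txy xa yb.
have [tree' nab] := tree_exchange treeT Txy xa yb.
have [[Ts Ti] _ Tac] := treeT.
have nxy : ~~ connect (del_edge T x y) x y.
  exact: del_edge_disconnect.
have es : symmetric (del_edge T x y) by exact: del_edge_sym.
have neq u v : ~~ connect (del_edge T x y) u v ->
    ~~ del_edge T x y u v /\ u != v.
  move=> nuv; split; first by apply: contraNN nuv => /connect1.
  by apply: contraNneq nuv => ->.
have [dab ab] := neq _ _ nab; have [dxy xy] := neq _ _ nxy.
have := maxT _ tree'; rewrite /cost ler_pM2r ?invr_gt0 //.
rewrite sum_add_edge //.
(* Both trees are now [del_edge T x y] plus one edge: the common sum cancels and the two lengths
   remain, each counted twice. *)
under [leRHS]eq_bigl => p do rewrite -(add_del_edge Ts Txy).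
rewrite sum_add_edge //= lerD2r -(enormN (val b - val a)) opprB.
rewrite -(enormN (val y - val x)) opprB.
lra.
Qed.

(** Pairing the vanishing combination with [z] exhibits 0 as a weighted mean of numbers that are at
    least [c]. *)
Lemma weighted_mean_dot (R : realType) (d : nat) (V : finType)
    (q : V -> 'rV[R]_d) (w : V -> R) (c : R) (z : 'rV[R]_d) :
    (forall k, 0 <= w k) -> \sum_k w k = 1 -> \sum_k w k *: q k = 0 ->
    (forall k, w k != 0 -> c <= dot z (q k)) -> c <= 0.
Proof.
move=> w0 w1 wq H.
have : \sum_k w k * c <= dot z (\sum_k w k *: q k).
  rewrite dot_sumr; apply: ler_sum => k _; rewrite dotZr.
  have [->|/H] := eqVneq (w k) 0; first by rewrite !mul0r.
  by apply: ler_wpM2l.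
by rewrite -mulr_suml w1 mul1r wq dotC dot0l.
Qed.

(* Splitting the balanced system into the sums over [A] and over its
   complement, these sums are opposite, so their inner product is [<= 0]. *)
Lemma balanced_bipartition (R : realType) (d : nat) (V : finType)
    (q : V -> 'rV[R]_d) (w : V -> R) (A : pred V) (c : R) (x y : 'rV[R]_d) :
    (forall k, 0 <= w k) -> \sum_k w k = 1 -> \sum_k w k *: q k = 0 ->
    (forall k, w k != 0 -> A k -> c <= dot y (q k)) ->
    (forall k, w k != 0 -> ~~ A k -> c <= dot x (q k)) ->
    (forall k l, w k != 0 -> w l != 0 -> A k -> ~~ A l ->
       c <= dot (q k) (q l)) ->
  c <= 0.
Proof.
move=> w0 w1 wq yA xB AB.
(* A side without weight would make the product of the two masses vanish, so these cases are treated
   apart, by pairing with [x] or [y]. *)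
have [[k Ak wk]|noA] := pselect (exists2 k, A k & w k != 0); last first.
  apply: (weighted_mean_dot (z := x) w0 w1 wq) => k wk; apply: xB => //.
  by apply/negP => Ak; apply: noA; exists k.
have [[l Bl wl]|noB] := pselect (exists2 l, ~~ A l & w l != 0); last first.
  apply: (weighted_mean_dot (z := y) w0 w1 wq) => l wl; apply: yA => //.
  by apply: contrapT => /negP Al; apply: noB; exists l.
set UA := \sum_(i | A i) w i *: q i.
set UB := \sum_(i | ~~ A i) w i *: q i.
have UBE : UB = - UA.
  by apply/eqP; rewrite -addr_eq0 addrC -wq [X in _ == X](bigID A).
have : (\sum_(i | A i) w i) * (\sum_(j | ~~ A j) w j) * c <= dot UA UB.
  rewrite dot_suml -mulrA mulr_suml; apply: ler_sum => i Ai; rewrite dotZl.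
  have [->|wi] := eqVneq (w i) 0; first by rewrite !mul0r.
  apply: ler_wpM2l => //; rewrite dot_sumr mulr_suml.
  apply: ler_sum => j Bj; rewrite dotZr.
  have [->|wj] := eqVneq (w j) 0; first by rewrite !mul0r.
  by apply: ler_wpM2l => //; exact: AB.
move/le_trans/(_ _); rewrite UBE dotNr => /(_ 0).
rewrite oppr_le0 dot_ge0 => /(_ isT); rewrite pmulr_rle0 // mulr_gt0 //.
  rewrite (bigD1 k) //= ltr_wpDr ?sumr_ge0 // lt_neqAle eq_sym wk; exact: w0.
rewrite (bigD1 l) //= ltr_wpDr ?sumr_ge0 // lt_neqAle eq_sym wl; exact: w0.
Qed.

(** * The smallest enclosing ball through its dual problem *)

Section EnclosingBall.
Variables (R : realType) (d : nat) (V : finType) (q : V -> 'rV[R]_d).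
Implicit Types w : V -> R.

(** For weights [w] this is the mean squared distance of the points to their weighted mean.
    Maximising it is the Lagrangian dual of minimising the squared radius of an enclosing ball. *)
Definition variance w : R :=
  \sum_k w k * dot (q k) (q k) -
  dot (\sum_k w k *: q k) (\sum_k w k *: q k).

Definition weights : set (V -> R) :=
  [set w | (forall k, 0 <= w k) /\ \sum_k w k = 1].

Lemma weights_le1 w k : weights w -> w k <= 1.
Proof. by move=> [w0 <-]; rewrite (bigD1 k) //= lerDl sumr_ge0. Qed.

Lemma variance_max (k0 : V) :
  exists2 w, weights w & forall w', weights w' -> variance w' <= variance w.
Proof.
pose coord (k : V) (r : 'rV[R]_#|V|) : R := r 0 (enum_rank k).
have coordC k : continuous (coord k) by exact: coord_continuous.
(* The simplex of weights is moved to row vectors, where closed bounded sets are compact. *)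
pose row_of (w : V -> R) : 'rV[R]_#|V| := \row_j w (enum_val j).
have row_ofK w : coord^~ (row_of w) = w.
  by apply/funext => k; rewrite /coord mxE enum_rankK.
pose S : set 'rV[R]_#|V| := [set r | weights (coord^~ r)].
have sumC (F : V -> R) : continuous (fun r => \sum_k coord k r * F k).
  apply: continuous_big => [|k _ r]; first exact: add_continuous.
  by apply: continuousM; [exact: coordC|exact: cst_continuous].
have S0 : S !=set0.
  exists (row_of (fun k => (k == k0)%:R)); rewrite /S /= row_ofK; split=> //.
  by rewrite (bigD1 k0) //= eqxx big1 ?addr0 // => k /negbTE->.
have compS : compact S.
  apply: bounded_closed_compact.
    exists 1; split => // M M1 r Sr; apply: le_trans (ltW M1).
    rewrite [leLHS]mx_normrE; apply/bigmax_leP; split => //= -[i j] _ /=.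
    rewrite ord1 -[j]enum_valK ger0_norm; last exact: Sr.1.
    exact: (weights_le1 _ Sr).
  have -> : S = (\bigcap_k (coord k @^-1` [set t | 0 <= t])) `&`
                ((fun r => \sum_k coord k r * 1) @^-1` [set 1]).
    apply/seteqP; split => r /=; rewrite /S /weights /=.
      move=> [h1 h2]; split; first by move=> k _; exact: h1.
      by under eq_bigr do rewrite mulr1.
    move=> [h1 h2]; split; first by move=> k; exact: h1.
    by under eq_bigr do rewrite -[coord _ _]mulr1.
  apply: closedI.
    apply: closed_bigI => k _; apply: preimage_closed; last exact: closed_ge.
    by move=> r _; exact: coordC.
  apply: preimage_closed; last exact: closed_eq.
  by move=> r _; exact: sumC.
have varC : continuous (fun r => variance (coord^~ r)).
  have varE r : variance (coord^~ r) = \sum_k coord k r * dot (q k) (q k) -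
      \sum_k coord k r * (\sum_l coord l r * dot (q k) (q l)).
    rewrite /variance; congr (_ - _); rewrite dot_suml; apply: eq_bigr => k _.
    by rewrite dotZl dot_sumr; under eq_bigr do rewrite dotZr.
  rewrite (funext varE) => r; apply: continuousB; first exact: sumC.
  apply: continuous_big r => [|k _ r]; first exact: add_continuous.
  by apply: continuousM; [exact: coordC|exact: sumC].
have [r rS rmax] := compact_EVT_max S0 compS (continuous_subspaceT varC).
exists (coord^~ r); first by move: rS; rewrite inE.
move=> w' Ww'; rewrite -(row_ofK w'); apply: rmax; rewrite inE /S /=.
by rewrite row_ofK.
Qed.

(* The weighted mean of a variance-maximal system of weights is the centre of
   the smallest ball enclosing the points. *)
Lemma enclosing_ball (k0 : V) : exists (w : V -> R) (p : 'rV[R]_d) (r : R),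
  [/\ weights w, \sum_k w k *: (q k - p) = 0,
      forall k, dot (q k - p) (q k - p) <= r &
      forall k, w k != 0 -> dot (q k - p) (q k - p) = r].
Proof.
have [w Ww wmax] := variance_max k0; have [w0 w1] := Ww.
pose p := \sum_k w k *: q k; pose r := variance w.
have le_r k : dot (q k - p) (q k - p) <= r.
  set s := dot _ _.
  (* Moving a fraction [t] of the mass to the point [k] gives variance
     [(1 - t) * r + t * (1 - t) * s], which is at most [r] by maximality. *)
  have step t : 0 < t -> t <= 1 -> s * (1 - t) <= r.
    move=> t0 t1; pose w' l := (1 - t) * w l + t * (l == k)%:R.
    have sum_w' (M : lmodType R) (F : V -> M) :
        \sum_l w' l *: F l = (1 - t) *: (\sum_l w l *: F l) + t *: F k.
      under eq_bigr do rewrite scalerDl -!scalerA.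
      rewrite big_split -!scaler_sumr /= [X in _ + _ *: X](bigD1 k) //=.
      rewrite eqxx scale1r [X in F k + X]big1 ?addr0 // => l /negbTE->.
      by rewrite scale0r.
    have sum_w'R (F : V -> R) :
        \sum_l w' l * F l = (1 - t) * (\sum_l w l * F l) + t * F k.
      exact: (sum_w' R^o).
    have Ww' : weights w'.
      split=> [l|]; first by rewrite addr_ge0 // mulr_ge0 ?subr_ge0 // ltW.
      have := sum_w'R (fun=> 1); rewrite -!mulr_suml w1 !mulr1 => ->.
      by rewrite subrK.
    have := wmax _ Ww'; rewrite -/r {1}/variance sum_w'R sum_w' -/p.
    have -> : \sum_l w l * dot (q l) (q l) = r + dot p p.
      by rewrite /r /variance subrK.
    move=> H.
    rewrite -(ler_pM2l t0); move: H; rewrite /s !dotE (dotC p (q k)); nra.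
  have r0 : 0 <= r by have := step 1 ltr01 (lexx _); rewrite subrr mulr0.
  rewrite leNgt; apply/negP => rs.
  have s0 : 0 < s by exact: le_lt_trans rs.
  (* This value replaces the limit [t -> 0]: it turns [s * (1 - t)] into the midpoint of [r] and
     [s], which exceeds [r] when [r < s]. *)
  have := step ((s - r) / (2 * s)).
  rewrite divr_gt0 ?subr_gt0 ?mulr_gt0 // => /(_ isT).
  rewrite ler_pdivrMr ?mulr_gt0 // => H.
  have : s - r <= 1 * (2 * s) by lra.
  move/H; have -> : s * (1 - (s - r) / (2 * s)) = (s + r) / 2.
    by field; rewrite gt_eqF.
  lra.
have bal : \sum_k w k *: (q k - p) = 0.
  under eq_bigr do rewrite scalerBr.
  by rewrite sumrB -scaler_suml w1 scale1r subrr.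
exists w, p, r; split=> // k wk.
(* Complementary slackness: [r] is the weighted mean of the squared distances to [p], none of which
   exceeds [r], so each one of nonzero weight equals [r]. *)
have : \sum_l w l * (r - dot (q l - p) (q l - p)) = 0.
  under eq_bigr do rewrite mulrBr.
  rewrite sumrB -mulr_suml w1 mul1r.
  have -> : \sum_l w l * dot (q l - p) (q l - p)
          = \sum_l w l * dot (q l) (q l) - dot p p.
    have -> : dot p p = \sum_l w l * (2 * dot (q l) p - dot p p).
      under [RHS]eq_bigr do rewrite mulrBr mulrCA -dotZl.
      by rewrite sumrB -mulr_sumr -mulr_suml w1 -dot_suml -/p; ring.
    rewrite -sumrB; apply: eq_bigr => l _.
    by rewrite !dotE (dotC p (q l)); ring.
  by rewrite /r /variance -/p subrr.
move/eqP; rewrite psumr_eq0 => [/allP/(_ k (mem_index_enum _))/=|l _].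
  by rewrite mulf_eq0 (negbTE wk) subr_eq0 => /eqP.
by rewrite mulr_ge0 ?subr_ge0.
Qed.

End EnclosingBall.

(** * The common point of the edge balls *)

Theorem theorem1 (R : realType) (d : nat) (hd : (1 <= d)%N)
  (X : {fset 'rV[R]_d}) (T : rel X) (hT : max_sum_tree T) :
  Tverberg_graph T.
Proof.
have [[k0 _]|X0] := pselect (exists2 k : X, True & True); last first.
  (* For empty [X] there is no edge and any point will do. *)
  by exists 0 => -[x y] _; case: X0; exists x.
have [w [p [r [[w0 w1] bal le_r eq_r]]]] :=
  enclosing_ball (fun k : X => val k) k0.
exists p => -[x y] /= Txy; apply/diam_ballE.
have [[Ts _] Tc _] := hT.1.
pose A := connect (del_edge T x y) x.
have xA : A x by exact: connect0.
have yB k : ~~ A k -> connect (del_edge T x y) y k.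
  by have := del_edge_sides x y k Ts Tc; rewrite -/A => /orP[->|].
set c := dot (val x - p) (val y - p).
(* The exchange inequality, squared and expanded around [p]. *)
have cut a b : A a -> connect (del_edge T x y) y b ->
    dot (val a - p) (val a - p) + dot (val b - p) (val b - p)
    - 2 * dot (val a - p) (val b - p) <=
    dot (val x - p) (val x - p) + dot (val y - p) (val y - p) - 2 * c.
  move=> Aa Bb; have := max_sum_tree_edge hT Txy Aa Bb; rewrite enorm_le.
  have sub (u v : 'rV[R]_d) : dot (u - v) (u - v) = dot (u - p) (u - p) +
      dot (v - p) (v - p) - 2 * dot (u - p) (v - p).
    by rewrite !dotE (dotC p u) (dotC p v) (dotC v u); ring.
  by rewrite (sub (val a) (val b)) (sub (val x) (val y)).
(* Vertices of nonzero weight have squared distance exactly [r] to [p], while [x] and [y] have at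
   most [r]; hence [cut] leaves a comparison of inner products with [c]. *)
have dx := le_r x; have dy := le_r y.
apply: (balanced_bipartition (A := A) (x := val x - p) (y := val y - p)
  w0 w1 bal).
- move=> k /eq_r dk Ak; have := cut k y Ak (connect0 _ _).
  by rewrite dk (dotC (val y - p)); lra.
- move=> k /eq_r dk /yB Bk; have := cut x k xA Bk.
  by rewrite dk; lra.
- move=> k l /eq_r dk /eq_r dl Ak /yB Bl; have := cut k l Ak Bl.
  by rewrite dk dl; lra.
Qed.
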